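(* Let $m\ge1$, let $I_1,\ldots,I_m$ be non-empty finite multisets of elements of $\mathcal I$, and let $Y^k=X^{\diamond_X I_k}$ for $k=1,\ldots,m$. Then, in $\mathbb R[x^{\mathcal I}]$, $$\bigl(y^1\diamond_Y\cdots\diamond_Y y^m\bigr)\big|_{y^j=x^{\diamond_X I_j},\ j=1,\ldots,m}=\sum_{\substack{(\pi,K)\in\mathcal D_{\mathrm{NF},\mathrm C}(I_1,\ldots,I_m)\\ |K|>0}}\kappa[X]^\pi\,x^{\diamond_X K}.$$
   Context: Let $(X^i)_{i\in\mathcal I}$ be a collection of real random variables on a probability space, all of whose mixed moments are finite, and let $(x^i)_{i\in\mathcal I}$ be commuting indeterminates, generating the polynomial algebra $\mathbb R[x^{\mathcal I}]$. For a finite multiset $I=\{i_1,\ldots,i_n\}$ of elements of $\mathcal I$ put $x^I=x^{i_1}\cdots x^{i_n}$, and let $\kappa[X^I]=\kappa[X^{i_1},\ldots,X^{i_n}]$ be the joint cumulant. Elements of a multiset, counted with multiplicity, are treated as distinguishable nodes: sums over $J\subset I$ run over all $2^{|I|}$ subsets of nodes, and $\mathcal P(I)$ is the set of partitions of the set of nodes of $I$ into non-empty blocks ($\mathcal P(\varnothing)=\{\varnothing\}$). For a partition $\pi$ put $\kappa[X]^\pi=\prod_{J\in\pi}\kappa[X^J]$, with $\kappa[X]^\varnothing=1$; $|\pi|$ is the number of blocks. Appell polynomials with respect to $X$: $x^{\diamond_X I}=\sum_{J\subset I}x^J\sum_{\pi\in\mathcal P(I\setminus J)}(-1)^{|\pi|}\kappa[X]^\pi$,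 with $x^{\diamond_X\varnothing}=1$; $X^{\diamond_X I}$ denotes the random variable obtained by substituting $x^i=X^i$. They form a linear basis of $\mathbb R[x^{\mathcal I}]$. The Wick product $\diamond_X$ is the bilinear (commutative, associative) product on $\mathbb R[x^{\mathcal I}]$ determined by $x^{\diamond_X I}\diamond_X x^{\diamond_X J}=x^{\diamond_X(I\sqcup J)}$. Given the random variables $Y=(Y^1,\ldots,Y^m)$ and indeterminates $y^1,\ldots,y^m$, $\diamond_Y$ is the analogous Wick product on $\mathbb R[y^1,\ldots,y^m]$ defined using the joint cumulants of $Y$ in place of those of $X$. Diagrams: given rows $I_1,\ldots,I_m$, let $I=I_1\sqcup\cdots\sqcup I_m$ (disjoint union of nodes). A diagram is a pair $(\pi,K)$ with $K\subset I$ a subset of nodes and $\pi\in\mathcal P(I\setminus K)$. It is non-flat if no block of $\pi$ is contained in a single row ($K$ is allowed to lie in a single row). Let $\overline\pi=\pi\sqcup\{K\}$. Two rows $i,j$ are equivalent if there are $H_1,\ldots,H_l\in\overline\pi$ such that $H_1$ intersects row $i$, $H_l$ intersects row $j$, and for each $k=1,\ldots,l-1$ the sets $H_k,H_{k+1}$ intersect a common row. The diagram is connected if this equivalence relation on $\{1,\ldots,m\}$ has a single class. $\mathcal D_{\mathrm{NF},\mathrm C}(I_1,\ldots,I_m)$ is the set of non-flat connected diagrams. *)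

(* Defs.v *)
From HB Require Import structures.
From mathcomp Require Import all_boot all_order all_algebra fingroup perm.
From mathcomp Require Import finmap.
From mathcomp Require Import all_classical all_reals all_analysis.
(* The notations of monalg are incompatible with those of mathcomp-analysis. *)
From mathcomp Require Import -(notations) monalg.

Set Implicit Arguments.
Unset Strict Implicit.
Unset Printing Implicit Defensive.

Import Order.TTheory GRing.Theory Num.Theory.
Local Open Scope ring_scope.

(* R[x^I]: polynomials in commuting indeterminates indexed by I (possibly
   infinite), as the monoid algebra of the free commutative monoid over I. *)
Notation polyring R I := (malg (cmonom I) R).

Section Polynomials.
Variables (R : realType) (I : choiceType).

Definition indet (i : I) : polyring R I := mkmalgU (ucm i) 1.

Definition peval (v : I -> R) (p : polyring R I) : R :=
  mmap idfun (fun m : cmonom I => \prod_(i <- finsupp m) v i ^+ m i) p.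

Definition psubst (J : choiceType) (v : I -> polyring R J) (p : polyring R I) :
    polyring R J :=
  mmap (mkmalgU (onecm J)) (fun m : cmonom I => \prod_(i <- finsupp m) v i ^+ m i) p.

End Polynomials.

(* A family of nodes is a finite type N; a multiset of indices is a labelling
   N -> I of the nodes, so that equal indices remain distinguishable nodes. *)
Section Cumulants.
Context {d : measure_display} {T : measurableType d} {R : realType}.
Variable (P : probability T R).

Section Nodes.
Variables (N : finType) (Z : N -> T -> R).

Definition moment (B : {set N}) : R :=
  fine 'E_P[fun w => \prod_(t in B) Z t w].

(* Leonov-Shiryaev moment formula for the joint cumulant; only meant for J
   non-empty. *)
Definition cumulant (J : {set N}) : R :=
  \sum_(pi : {set {set N}} | finset.partition pi J)
    (-1) ^+ (#|pi|.-1) * (#|pi|.-1)`!%:R * \prod_(B in pi) moment B.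

Definition cumulant_part (pi : {set {set N}}) : R :=
  \prod_(J in pi) cumulant J.

End Nodes.

Section Appell.
Variables (I : choiceType) (X : I -> T -> R).

Definition appell (N : finType) (lab : N -> I) (D : {set N}) : polyring R I :=
  \sum_(J : {set N} | J \subset D)
    (\sum_(pi : {set {set N}} | finset.partition pi (D :\: J))
        (-1) ^+ #|pi| * cumulant_part (X \o lab) pi)
      *: \prod_(t in J) indet R (lab t).

(* The multiset {i_1, ..., i_n} enumerated as a sequence: its nodes are the
   positions in the sequence. *)
Definition appell_seq (s : seq I) : polyring R I :=
  appell (tnth (in_tuple s)) [set: 'I_(size s)]%SET.

Definition appell_rv (s : seq I) : T -> R :=
  fun w => peval (fun i => X i w) (appell_seq s).

Definition is_wick_product (op : polyring R I -> polyring R I -> polyring R I) :=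
  [/\ forall a p q r, op (a *: p + q) r = a *: op p r + op q r,
      forall a p q r, op r (a *: p + q) = a *: op r p + op r q
    & forall s t, op (appell_seq s) (appell_seq t) = appell_seq (s ++ t)].

End Appell.
End Cumulants.

Section WickProduct.
Context {d : measure_display} {T : measurableType d} {R : realType}.
Variables (P : probability T R) (I : choiceType) (X : I -> T -> R).
Local Notation A := (polyring R I).
Local Notation xm m := (mkmalgU (m : cmonom I) (1 : R)).

Let coef (N : finType) (lab : N -> I) (D : {set N}) : R :=
  \sum_(pi : {set {set N}} | finset.partition pi D)
     (-1) ^+ #|pi| * cumulant_part P (X \o lab) pi.

Lemma appell_bij (N N' : finType) (f : N -> N') (lab : N' -> I)
    (D : {set N}) : bijective f ->
  appell P X (lab \o f) D = appell P X lab (f @: D).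
Proof.
move=> bf; have injf := bij_inj bf.
have imset_bij (U V : finType) (h : U -> V) : bijective h ->
    bijective (fun B : {set U} => h @: B).
  case=> g hK gK; exists (fun B : {set V} => g @: B) => B /=.
    by rewrite -imset_comp (eq_imset _ hK) imset_id.
  by rewrite -imset_comp (eq_imset _ gK) imset_id.
have bF := imset_bij _ _ _ bf; have injF := bij_inj bF.
have bFF := imset_bij _ _ _ bF.
have momE (B : {set N}) :
    moment P ((X \o lab) \o f) B = moment P (X \o lab) (f @: B).
  rewrite /moment; congr (fine (expectation P _)); apply/funext => w.
  by rewrite big_imset//= => ? ? _ _; exact: injf.
have cumE (B : {set N}) :
    cumulant P ((X \o lab) \o f) B = cumulant P (X \o lab) (f @: B).
  rewrite /cumulant (reindex _ (onW_bij _ bFF))/=.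
  apply: eq_big => [pi|pi _]; first by rewrite imset_partition.
  rewrite (card_imset _ injF) big_imset/=; last by move=> ? ? _ _; exact: injF.
  by congr (_ * _); apply: eq_bigr => C _; rewrite momE.
rewrite /appell [RHS](reindex _ (onW_bij _ bF))/=.
apply: eq_big => [J|J _].
  apply/idP/idP => [|/fintype.subsetP sJD]; first exact: imsetS.
  by apply/fintype.subsetP => t tJ; rewrite -(mem_imset _ _ injf) sJD ?imset_f.
apply: (congr2 *:%R); last by rewrite big_imset//= => ? ? _ _; exact: injf.
rewrite [RHS](reindex _ (onW_bij _ bFF))/=.
apply: eq_big => [pi|pi _].
  have -> : (f @: D :\: f @: J)%SET = (f @: (D :\: J))%SET.
    apply/finset.setP => u; have [t ->] : exists t, u = f t.
      by case: bf => g _ gK; exists (g u); rewrite gK.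
    by rewrite !inE !(mem_imset _ _ injf) inE.
  by rewrite imset_partition.
rewrite (card_imset _ injF); congr (_ * _); rewrite /cumulant_part.
rewrite big_imset/=; last by move=> ? ? _ _; exact: injF.
by apply: eq_bigr => C _; rewrite -cumE.
Qed.

Lemma appell_bijT (N N' : finType) (f : N -> N') (lab : N' -> I) : bijective f ->
  appell P X (lab \o f) [set: N]%SET = appell P X lab [set: N']%SET.
Proof.
move=> bf; rewrite (appell_bij _ _ bf).
suff -> : (f @: [set: N]%SET)%SET = [set: N']%SET by [].
apply/finset.setP => u; rewrite inE; apply/imsetP.
by case: bf => g _ gK; exists (g u).
Qed.

Lemma appell_seq_perm (s t : seq I) : perm_eq s t ->
  appell_seq P X s = appell_seq P X t.
Proof.
move=> st; have [p sE] := elimT (@tuple_permP _ _ s (in_tuple t)) st.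
have szE : size s = size t by exact: perm_size.
have labE : tnth (in_tuple s) = tnth (in_tuple t) \o (p \o cast_ord szE).
  apply/funext => i /=; rewrite -(tnth_mktuple (fun i => tnth (in_tuple t) (p i))).
  have x0 : I := tnth (in_tuple s) i.
  by rewrite !(tnth_nth x0)/= {1}sE.
rewrite /appell_seq labE appell_bijT//.
apply: bij_comp; first exact: injF_bij (@perm_inj _ p).
by exists (cast_ord (esym szE)); [exact: cast_ordK|exact: cast_ordKV].
Qed.

Let mon (s : seq I) : cmonom I := \big[@mulcm I/onecm I]_(i <- s) ucm i.

Let mseq (m : cmonom I) : seq I := flatten [seq nseq (m i) i | i <- finsupp m].

Let monE s i : mon s i = count_mem i s.
Proof.
rewrite /mon; elim: s => [|j s IH]; first by rewrite big_nil onecmE.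
by rewrite big_cons mulcmE ucmE IH /= eq_sym.
Qed.

Let count_mseq m i : count_mem i (mseq m) = m i.
Proof.
rewrite /mseq count_flatten -map_comp sumnE big_map/=.
have [im|im] := boolP (i \in finsupp m); last first.
  rewrite big1_seq ?(fsfun_dflt im)// => j /andP[_ jm].
  rewrite count_nseq/=; case: eqP => [ji|]; rewrite ?mul0n//.
  by rewrite -ji jm in im.
rewrite (big_rem i im)/= count_nseq/= eqxx mul1n big1_seq ?addn0// => j.
rewrite count_nseq/= => jm; case: eqP => [ji|]; rewrite ?mul0n//.
by move: jm; rewrite ji mem_rem_uniqF// fset_uniq.
Qed.

Let mseqK m : mon (mseq m) = m.
Proof. by apply/eqP/cmP => i; rewrite monE count_mseq. Qed.

Let perm_mseq s : perm_eq s (mseq (mon s)).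
Proof. by apply/allP => i _ /=; rewrite count_mseq monE. Qed.

Let mon_cat s t : mon (s ++ t) = mulcm (mon s) (mon t).
Proof.
by apply/eqP/cmP => i; rewrite mulcmE !monE count_cat.
Qed.

Let mdeg_mon s : mdeg (mon s) = size s.
Proof.
elim: s => [|i s IH]; rewrite /mon ?big_nil ?big_cons; first exact: mdeg1.
by rewrite -/(mon s) (mdegM (ucm i)) mdegU IH.
Qed.

Let nodes m := 'I_(size (mseq m)).
Let lab m : nodes m -> I := tnth (in_tuple (mseq m)).
Let smon m (J : {set nodes m}) : cmonom I := mon [seq lab t | t <- enum J].

Let xmM m m' : xm m * xm m' = xm (mulcm m m') :> A.
Proof. by rewrite malgM_def fgmulUU mulr1. Qed.

Let prod_indet s : \prod_(i <- s) indet R i = xm (mon s).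
Proof.
rewrite /mon; elim: s => [|i s IH].
  by rewrite !big_nil.
rewrite !big_cons IH.
rewrite /indet.
rewrite xmM.
reflexivity.
Qed.

Let mdeg_smon m (J : {set nodes m}) : J != [set: nodes m]%SET ->
  (mdeg (smon J) < mdeg m)%N.
Proof.
move=> JT; rewrite mdeg_mon size_map -cardE -[X in (_ < mdeg X)%N]mseqK mdeg_mon.
rewrite -[X in (_ < X)%N]card_ord -cardsT; apply: proper_card.
by rewrite properE finset.subsetT/= finset.subTset.
Qed.

Let smonT m : smon [set: nodes m]%SET = m.
Proof.
rewrite -[RHS]mseqK /smon; congr mon.
rewrite -[RHS](map_tnth_enum (in_tuple (mseq m))).
by congr map; apply/eq_enum => t; rewrite inE.
Qed.

Let coef0 (N : finType) (l : N -> I) : coef l finset.set0 = 1.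
Proof.
rewrite /coef (big_pred1 finset.set0) => [|pi]; last exact: partition_set0.
by rewrite cards0 expr0 mul1r /cumulant_part big_set0.
Qed.

Let big_subT (V : nmodType) (N : finType) (F : {set N} -> V) :
  \sum_(J : {set N} | J \subset [set: N]%SET) F J =
    F [set: N]%SET + \sum_(J : {set N} | J != [set: N]%SET) F J.
Proof.
rewrite (bigD1 [set: N]%SET)/=; last exact: finset.subsetT.
by congr (_ + _); apply: eq_bigl => J; rewrite finset.subsetT.
Qed.

Let appellTE (N : finType) (l : N -> I) :
  appell P X l [set: N]%SET =
    \prod_(t in [set: N]%SET) indet R (l t) +
    \sum_(J : {set N} | J != [set: N]%SET)
       coef l (~: J) *: \prod_(t in J) indet R (l t).
Proof.
apply: (etrans (big_subT _)).
rewrite finset.setDv -/(coef l finset.set0) coef0 scale1r.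
apply: (congr2 +%R); first reflexivity.
by apply: eq_bigr => J _; rewrite finset.setTD.
Qed.

Let appell_mseq m :
  appell_seq P X (mseq m) =
    xm m + \sum_(J : {set nodes m} | J != [set: nodes m]%SET)
             coef (@lab m) (~: J) *: xm (smon J).
Proof.
have monJ (J : {set nodes m}) : \prod_(t in J) indet R (lab t) = xm (smon J).
  by rewrite /smon -prod_indet big_map big_enum.
rewrite /appell_seq appellTE.
rewrite monJ smonT.
apply: (congr2 +%R); first reflexivity.
by apply: eq_bigr => J _; rewrite monJ.
Qed.

Let lext (h : cmonom I -> A) (p : A) : A := \sum_(m <- msupp p) mcoeff m p *: h m.

Let lextEw h (D : {fset cmonom I}) p : fsubset (msupp p) D ->
  lext h p = \sum_(m <- D) mcoeff m p *: h m.
Proof.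
move=> le; rewrite /lext (big_fset_incl _ le)// => m _ /mcoeff_outdom ->.
by rewrite scale0r.
Qed.

Let lext_linear h a p q : lext h (a *: p + q) = a *: lext h p + lext h q.
Proof.
pose D := fsetU (msupp (a *: p + q)) (fsetU (msupp p) (msupp q)).
have Dpq : fsubset (msupp (a *: p + q)) D by exact: fsubsetUl.
have Dp : fsubset (msupp p) D by exact: fsubset_trans (fsubsetUl _ _) (fsubsetUr _ _).
have Dq : fsubset (msupp q) D by exact: fsubset_trans (fsubsetUr _ _) (fsubsetUr _ _).
rewrite (lextEw h Dpq) (lextEw h Dp) (lextEw h Dq).
rewrite scaler_sumr -big_split/=; apply: eq_bigr => m _.
by rewrite mcoeffD mcoeffZ scalerDl scalerA.
Qed.

Let lextU h m : lext h (xm m) = h m.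
Proof.
by rewrite (@lextEw h _ _ msuppU_le) big_seq_fset1 mcoeffUU scale1r.
Qed.

Let linear_sum (V W : lmodType R) (h : V -> W) (J : finType) (Q : pred J)
    (c : J -> R) (F : J -> V) :
  (forall a p q, h (a *: p + q) = a *: h p + h q) ->
  h (\sum_(j | Q j) c j *: F j) = \sum_(j | Q j) c j *: h (F j).
Proof.
move=> hl; have h0 : h 0 = 0.
  by have := hl (-1) 0 0; rewrite !scaleN1r !addNr.
by apply: (big_rec2 (fun p q => h p = q)) => // j p q _ <-; rewrite hl.
Qed.

Let subr_sumK (V : zmodType) (J : finType) (Q : pred J) (p : V) (F G : J -> V) :
  (forall j, Q j -> F j = G j) ->
  p - \sum_(j | Q j) F j + \sum_(j | Q j) G j = p.
Proof. by move=> FG; rewrite (eq_bigr G FG) subrK. Qed.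

Let appell_lin : A -> A := lext (fun m => appell_seq P X (mseq m)).

Let appell_lin_mon s : appell_lin (xm (mon s)) = appell_seq P X s.
Proof.
by rewrite /appell_lin lextU; apply: appell_seq_perm; rewrite perm_sym perm_mseq.
Qed.

(* Left inverse of appell_lin, by recursion on the degree (n is fuel). *)
Let Fixpoint inv_rec n (m : cmonom I) : A :=
  if n is n'.+1 then
    xm m - \sum_(J : {set nodes m} | J != [set: nodes m]%SET)
             coef (@lab m) (~: J) *: inv_rec n' (smon J)
  else 0.

Let inv_rec_fuel n n' m : (mdeg m < n)%N -> (mdeg m < n')%N ->
  inv_rec n m = inv_rec n' m.
Proof.
elim: n n' m => [|n IH] [|n'] m mn mn'; rewrite ?ltn0 in mn mn'.
- discriminate.
- discriminate.
- discriminate.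
apply: (congr1 (fun p => xm m - p)); apply: eq_bigr => J JT.
have lt k : (mdeg m < k.+1)%N -> (mdeg (smon J) < k)%N.
  by move=> mk; apply: leq_trans (mdeg_smon JT) _.
exact: (congr1 ( *:%R _) (IH n' _ (lt _ mn) (lt _ mn'))).
Qed.

Let appell_inv : A -> A := lext (fun m => inv_rec (mdeg m).+1 m).

Let appell_invK s : appell_inv (appell_seq P X s) = xm (mon s).
Proof.
rewrite (appell_seq_perm (perm_mseq s)) appell_mseq; set m := mon s.
rewrite -[X in X + _]scale1r /appell_inv lext_linear scale1r lextU.
rewrite linear_sum; last by move=> a p q; exact: lext_linear.
apply: subr_sumK => J JT; rewrite lextU; apply: (congr1 ( *:%R _)).
by apply: inv_rec_fuel; rewrite ?ltnS//; exact: mdeg_smon.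
Qed.

Lemma exists_wick_product : exists op, is_wick_product P X op.
Proof.
exists (fun p q => appell_lin (appell_inv p * appell_inv q)); split.
- by move=> a p q r; rewrite /appell_inv lext_linear mulrDl -scalerAl
    /appell_lin lext_linear.
- by move=> a p q r; rewrite /appell_inv lext_linear mulrDr -scalerAr
    /appell_lin lext_linear.
- by move=> s t; rewrite !appell_invK xmM -mon_cat appell_lin_mon.
Qed.

Lemma appell_span (Q : A -> Prop) :
  (forall a p q, Q p -> Q q -> Q (a *: p + q)) ->
  (forall s, Q (appell_seq P X s)) -> forall p, Q p.
Proof.
move=> Ql QA; have Q0 : Q 0.
  by have := Ql (-1) _ _ (QA [::]) (QA [::]); rewrite scaleN1r addNr.
have Qm m : Q (xm m).
  have [n] := ubnP (mdeg m); elim: n m => // n IH m mn.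
  have -> : xm m = (-1) *: (\sum_(J : {set nodes m} | J != [set: nodes m]%SET)
      coef (@lab m) (~: J) *: xm (smon J)) + appell_seq P X (mseq m).
    by rewrite appell_mseq scaleN1r [xm m + _]addrC addKr.
  apply: (Ql); last exact: QA.
  apply: (big_ind Q) => [|p q Qp Qq|J JT]; first exact: Q0.
    by rewrite -[p]scale1r; exact: Ql.
  rewrite -[X in Q X]addr0; apply: (Ql); last exact: Q0.
  by apply: IH; apply: leq_trans (mdeg_smon JT) _.
move=> p; rewrite [p]monalgE; apply: (big_ind Q) => [|u v Qu Qv|m _].
- exact: Q0.
- by rewrite -[u]scale1r; exact: Ql.
have -> : mkmalgU m (mcoeff m p) = mcoeff m p *: xm m + 0.
  move: (mcoeff m p) => c; rewrite addr0; apply/malgP => k.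
  apply: etrans (mcoeffU _ _ _) _.
  apply: etrans _ (esym (mcoeffZ _ _ _)).
  apply: etrans _ (congr1 ( *%R c) (esym (mcoeffU _ _ _))).
  by rewrite mulrnAr mulr1.
by apply: (Ql); [exact: Qm|exact: Q0].
Qed.

Lemma wick_product_unique op op' :
  is_wick_product P X op -> is_wick_product P X op' -> op = op'.
Proof.
move=> [l r e] [l' r' e']; apply/funext => p; apply/funext => q.
elim/appell_span : p => [a p p' IH IH'|s]; first by rewrite l l' IH IH'.
elim/appell_span : q => [a q q' IH IH'|t]; first by rewrite r r' IH IH'.
by rewrite e e'.
Qed.

Definition wick : A -> A -> A := sval (cid exists_wick_product).

Lemma wickP : is_wick_product P X wick.
Proof. exact: svalP (cid exists_wick_product). Qed.

Lemma wickC : commutative wick.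
Proof.
have [l r e] := wickP.
have : is_wick_product P X (fun p q => wick q p).
  split=> [a p q u|a p q u|s t]; rewrite ?l ?r ?e//.
  by apply: appell_seq_perm; rewrite perm_catC.
by move=> /(wick_product_unique wickP) E p q; rewrite {1}E.
Qed.

Lemma wickA : associative wick.
Proof.
have [l r e] := wickP => p q u.
elim/appell_span : p => [a p p' IH IH'|s]; first by rewrite !l IH IH'.
elim/appell_span : q => [a q q' IH IH'|t]; first by rewrite !(l, r) IH IH'.
elim/appell_span : u => [a u u' IH IH'|v]; first by rewrite !r IH IH'.
by rewrite !e catA.
Qed.

Lemma wick1 : left_id 1 wick.
Proof.
have [l r e] := wickP => p.
have -> : 1 = appell_seq P X [::].
  rewrite (appell_seq_perm (perm_mseq [::])) appell_mseq big1 ?addr0.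
    by rewrite /mon big_nil.
  move=> J /negP[]; apply/eqP/finset.setP => i; exfalso.
  have := leq_trans (ltn_ord i) (eq_leq (esym (perm_size (perm_mseq [::])))).
  by rewrite ltn0.
by elim/appell_span : p => [a q q' IH IH'|s]; rewrite ?r ?IH ?IH' ?e.
Qed.

End WickProduct.

Section Diagrams.
Variables (N : finType) (m : nat) (row_of : N -> 'I_m).

Definition meets_row (H : {set N}) (k : 'I_m) : bool :=
  [exists t in H, row_of t == k].

Definition in_row (H : {set N}) (k : 'I_m) : bool :=
  [forall t in H, row_of t == k].

Definition is_diagram (pi : {set {set N}}) (K : {set N}) : bool :=
  finset.partition pi (~: K).

Definition nonflat (pi : {set {set N}}) : bool :=
  [forall B in pi, forall k, ~~ in_row B k].

(* H :: s is the chain H_1, ..., H_l. *)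
Definition row_equiv (pibar : {set {set N}}) (i j : 'I_m) : Prop :=
  exists (H : {set N}) (s : seq {set N}),
    [/\ all (mem pibar) (H :: s), meets_row H i, meets_row (last H s) j
      & path (fun A B => [exists k, meets_row A k && meets_row B k]) H s].

Definition connected_diagram (pi : {set {set N}}) (K : {set N}) : Prop :=
  forall i j, row_equiv (K |: pi)%SET i j.

Definition diagram_NFC (pi : {set {set N}}) (K : {set N}) : Prop :=
  [/\ is_diagram pi K, nonflat pi & connected_diagram pi K].

End Diagrams.

(* Nodes of the disjoint union of the rows r 0, ..., r (m - 1). *)
Section RowNodes.
Variables (I : choiceType) (m : nat) (r : 'I_m -> seq I).

Definition row_node : finType := {k : 'I_m & 'I_(size (r k))}.

Definition node_row (t : row_node) : 'I_m := tag t.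

Definition node_label (t : row_node) : I := tnth (in_tuple (r (tag t))) (tagged t).

End RowNodes.

(* Main.v *)
Require Import Defs.
From HB Require Import structures.
From mathcomp Require Import all_boot all_order all_algebra.

Set Implicit Arguments.
Unset Strict Implicit.
Unset Printing Implicit Defensive.

Import Order.TTheory GRing.Theory Num.Theory.
Local Open Scope ring_scope.

(** Functions on the finite subsets of a set of nodes form a commutative ring
    under subset convolution, where [f * g] sums [f J * g (D \ J)] over [J] in
    [D].  Summing products of [f] over the blocks of all partitions of [D] is
    the exponential of [f] in this ring ([partexp]): it turns sums into
    convolutions ([partexpD]), and the Leonov-Shiryaev formula is its inverse
    ([partexp_log]).  Hence moments are the exponential of cumulants, and the
    Appell polynomials are the exponential of [e - kappa], where [e] carries the
    indeterminates on the singletons and [kappa] is the cumulant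
    ([appell_partexp]).

    Restricting [f] to the sets contained in one row turns the exponential into
    the product of the exponentials along the rows ([partexp_flat]).  A product
    of row-wise Appell polynomials is therefore the exponential of
    [e - (flat part of kappa)] = [(e - kappa) + (non-flat part of kappa)], that
    is, the convolution of the Appell polynomials with the exponential [mu] of
    the non-flat part of [kappa] ([prod_rows]).  This is the sum over all
    non-flat diagrams [(pi, K)].  Its expectation only keeps [K] empty, since an
    Appell polynomial of positive degree is centred ([pexpect_appell]); so [mu],
    read on unions of rows, gives the joint moments of the [Y k]
    ([moment_rows]).

    In a non-flat diagram on a set [S] of rows with [K] non-empty, let [J] be the
    set of rows connected to [K].  The diagram splits into a connected diagram on
    [J] and a partition of the nodes of the remaining rows
    ([partexp_row_component]).  With [C] the sum over the connected diagrams,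
    this says that the product over the rows is the convolution of [delta + C]
    with the moments of [Y], [delta] being the unit ([subconv_connected]).
    Convolving with the inverse of these moments, which is the exponential of
    minus the cumulants of [Y], leaves [delta + C] on the right
    ([wick_expansion]).  On the left this convolution is the Appell polynomial
    of [y^1, ..., y^m] with respect to [Y], evaluated at the row-wise Appell
    polynomials ([psubst_appell_rows]), and that Appell polynomial is the Wick
    power because each [Y k] is centred ([big_wick_indetT]). *)

(** * Subset convolution and the partition exponential *)

Section SetFunctions.
Variable N : finType.
Implicit Types (B D E J K : {set N}) (pi : {set {set N}}).

Lemma subsetD_disjoint B E D :
  (E \subset D :\: B) = (E \subset D) && [disjoint B & E].
Proof. by rewrite subsetD disjoint_sym. Qed.

(** Both sides run over the ordered splittings of [D] into three pieces; the
    predicate constrains the first piece. *)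
Lemma sum_subset_chain (V : nmodType) (Q : pred {set N})
    (H : {set N} -> {set N} -> {set N} -> V) D :
  \sum_(J : {set N} | J \subset D) \sum_(B : {set N} | (B \subset J) && Q B)
     H B (J :\: B) (D :\: J) =
  \sum_(B : {set N} | (B \subset D) && Q B)
     \sum_(E : {set N} | E \subset D :\: B) H B E (D :\: B :\: E).
Proof.
rewrite (exchange_big_dep (fun B => (B \subset D) && Q B)) /=; last first.
  by move=> J B sJD /andP[sBJ ->]; rewrite (subset_trans sBJ sJD).
apply: eq_bigr => B /andP[sBD QB].
rewrite (reindex_onto (fun E => B :|: E) (fun J => J :\: B)) /=; last first.
  by move=> J /and3P[_ sBJ _]; rewrite -{1}(setIidPr sBJ) setID.
apply: eq_big => [E | E /andP[_ /eqP ->]]; last by rewrite setDDl.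
rewrite subUset sBD QB subsetUl andbT /= setDUl setDv set0U subsetD_disjoint.
rewrite andbT; congr (_ && _); rewrite disjoint_sym.
by apply/eqP/idP => [/setDidPl|/setDidPl].
Qed.

Lemma sum_subset_compl (V : nmodType) (H : {set N} -> {set N} -> V) D :
  \sum_(J : {set N} | J \subset D) H J (D :\: J) =
  \sum_(J : {set N} | J \subset D) H (D :\: J) J.
Proof.
rewrite [RHS](reindex_onto (fun J => D :\: J) (fun J => D :\: J)) /=; last first.
  by move=> J sJD; rewrite setDDr setDv set0U; apply/setIidPr.
apply: eq_big => [J | J sJD]; rewrite ?subsetDl //= setDDr setDv set0U.
  by apply/setIidPr/eqP.
by rewrite (setIidPr sJD).
Qed.

(** Removing the marked block of a partition is inverse to adjoining it.  Both
    the recursion at a node and the logarithm come from this bijection. *)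
Lemma sum_partition_block (V : nmodType) (h : {set N} -> {set {set N}} -> V) D :
  \sum_(pi | partition pi D) \sum_(B in pi) h B (pi :\ B) =
  \sum_(B : {set N} | (B \subset D) && (B != set0))
     \sum_(pi | partition pi (D :\: B)) h B pi.
Proof.
rewrite (exchange_big_dep (fun B => (B \subset D) && (B != set0))) /=; last first.
  by move=> pi B piD Bpi; rewrite (partitionS piD Bpi) (partition_neq0 piD Bpi).
apply: eq_bigr => B /andP[sBD B0].
rewrite (reindex_onto (fun pi => B |: pi) (fun pi => pi :\ B)) /=; last first.
  by move=> pi /andP[_ Bpi]; rewrite setD1K.
apply: eq_big => [pi | pi /andP[_ /eqP ->]//].
rewrite setU11 andbT; apply/andP/idP => [[piD /eqP <-]|piD].
  by apply: partitionD1 => //; rewrite setU11.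
have Bpi : B \notin pi.
  apply/negP => Bpi; move: (partitionS piD Bpi).
  by rewrite subsetD_disjoint -setI_eq0 setIid (negPf B0) andbF.
split; last by rewrite setU1K.
rewrite -(setID D B) (setIidPr sBD); apply: partitionU1 => //.
by rewrite disjoints_subset setDE setCI setCK subsetUr.
Qed.

Variable A : comNzRingType.
Implicit Types (f g : {set N} -> A).

Definition subconv f g D : A :=
  \sum_(J : {set N} | J \subset D) f J * g (D :\: J).

Definition partexp f D : A :=
  \sum_(pi | partition pi D) \prod_(B in pi) f B.

Definition partsum (c : nat -> A) f D : A :=
  \sum_(pi | partition pi D) c #|pi| * \prod_(B in pi) f B.

Lemma partexpE f : partexp f =1 partsum (fun=> 1) f.
Proof. by move=> D; apply: eq_bigr => pi _; rewrite mul1r. Qed.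

Lemma eq_subconv f f' g g' D : (forall E, E \subset D -> f E = f' E) ->
  (forall E, E \subset D -> g E = g' E) -> subconv f g D = subconv f' g' D.
Proof.
by move=> ff gg; apply: eq_bigr => J sJD; rewrite ff// gg// subsetDl.
Qed.

Lemma subconvC f g D : subconv f g D = subconv g f D.
Proof.
rewrite /subconv (sum_subset_compl (fun J E => f J * g E)).
by apply: eq_bigr => J _; rewrite mulrC.
Qed.

Lemma subconvA f g h D : subconv (subconv f g) h D = subconv f (subconv g h) D.
Proof.
transitivity (\sum_(J : {set N} | J \subset D)
    \sum_(B : {set N} | (B \subset J) && xpredT B)
     f B * g (J :\: B) * h (D :\: J)).
  apply: eq_bigr => J _; rewrite mulr_suml.
  by apply: eq_bigl => B; rewrite andbT.
rewrite (sum_subset_chain xpredT (fun B J E => f B * g J * h E)).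
apply: eq_big => [B|B _]; first by rewrite andbT.
by rewrite mulr_sumr; apply: eq_bigr => E _; rewrite mulrA.
Qed.

Lemma subconv1 f D : subconv f (fun E => (E == set0)%:R) D = f D.
Proof.
rewrite /subconv (bigD1 D) //= setDv eqxx mulr1 big1 ?addr0 // => J /andP[sJD JD].
rewrite setD_eq0; case: (boolP (D \subset J)) => [sDJ|_]; last by rewrite mulr0.
by rewrite eqEsubset sJD sDJ in JD.
Qed.

Lemma partexp0 f : partexp f set0 = 1.
Proof.
rewrite /partexp (big_pred1 set0) => [|pi]; last exact: partition_set0.
by rewrite big_set0.
Qed.

(** Classify the partitions by the block that contains [x]. *)
Lemma partsum_rec c f D x : x \in D ->
  partsum c f D = \sum_(B : {set N} | (B \subset D) && (x \in B))
                    f B * partsum (c \o succn) f (D :\: B).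
Proof.
move=> xD.
pose h B pi := if x \in B then c #|pi|.+1 * (f B * \prod_(C in pi) f C) else 0.
transitivity (\sum_(pi | partition pi D) \sum_(B in pi) h B (pi :\ B)).
  apply: eq_bigr => pi piD.
  have xpi : x \in cover pi by rewrite (cover_partition piD).
  have Ppi := pblock_mem xpi; have xP : x \in pblock pi x by rewrite mem_pblock.
  rewrite [RHS](bigD1 _ Ppi) /= [in RHS]/h xP [X in _ + X]big1 => [|B]; last first.
    move=> /andP[Bpi BP]; case: ifP => // xB; case/eqP: BP.
    by rewrite (def_pblock (partition_trivIset piD) Bpi xB).
  rewrite addr0 (cardsD1 (pblock pi x) pi) Ppi (big_setD1 _ Ppi) /=.
  by congr (_ * (_ * _)); apply: eq_bigl => C; rewrite !inE.
rewrite sum_partition_block big_mkcondr /= [RHS]big_mkcondr /=.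
apply: eq_bigr => B _; case: ifP => [_|]; last first.
  by move=> /negbT; rewrite negbK => /eqP ->; rewrite inE.
rewrite /h; case: ifP => xB; last by rewrite big1.
by rewrite mulr_sumr; apply: eq_bigr => pi _; rewrite mulrCA.
Qed.

Lemma partexp_rec f D x : x \in D ->
  partexp f D = \sum_(B : {set N} | (B \subset D) && (x \in B)) f B * partexp f (D :\: B).
Proof.
move=> xD; rewrite partexpE (partsum_rec _ _ xD).
by apply: eq_bigr => B _; rewrite partexpE.
Qed.

(** The recursion at a node is the differential equation of the exponential,
    which determines it by induction on the cardinality. *)
Lemma partexp_unique f g : g set0 = 1 ->
  (forall D x, x \in D ->
     g D = \sum_(B : {set N} | (B \subset D) && (x \in B)) f B * g (D :\: B)) ->
  forall D, g D = partexp f D.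
Proof.
move=> g0 grec D; have [n] := ubnP #|D|; elim: n D => // n IH D Dn.
have [->|/set0Pn[x xD]] := eqVneq D set0; first by rewrite g0 partexp0.
rewrite (grec _ _ xD) (partexp_rec _ xD); apply: eq_bigr => B /andP[sBD xB].
rewrite IH //; apply: (@leq_trans #|D|) Dn; apply: proper_card.
rewrite properE subsetDl; apply/subsetPn; exists x => //.
by rewrite inE xB.
Qed.

Lemma eq_partexp f g D : (forall B, B \subset D -> B != set0 -> f B = g B) ->
  partexp f D = partexp g D.
Proof.
move=> fg; apply: eq_bigr => pi piD; apply: eq_bigr => B Bpi.
by apply: fg; [exact: partitionS piD Bpi | exact: partition_neq0 piD Bpi].
Qed.

(** By uniqueness: the convolution splits according to the factor that receives
    the node [x], and each half obeys the recursion of its own factor. *)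
Lemma partexpD f g D :
  partexp (fun B => f B + g B) D = subconv (partexp f) (partexp g) D.
Proof.
suff : forall D, subconv (partexp f) (partexp g) D = partexp (fun B => f B + g B) D.
  by move=> ->.
(* The terms of the convolution whose first factor receives [x]. *)
have half f1 f2 E x : x \in E ->
    \sum_(J : {set N} | (J \subset E) && (x \in J)) partexp f1 J * partexp f2 (E :\: J)
    = \sum_(B : {set N} | (B \subset E) && (x \in B)) f1 B * subconv (partexp f1) (partexp f2) (E :\: B).
  move=> xE.
  transitivity (\sum_(J : {set N} | J \subset E)
    \sum_(B : {set N} | (B \subset J) && (x \in B))
      f1 B * partexp f1 (J :\: B) * partexp f2 (E :\: J)).
    rewrite big_mkcondr; apply: eq_bigr => J _; case: ifP => xJ.
      by rewrite (partexp_rec _ xJ) mulr_suml.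
    by rewrite big1 // => B /andP[/subsetP sBJ /sBJ]; rewrite xJ.
  rewrite (sum_subset_chain (fun B => x \in B)
             (fun B J K => f1 B * partexp f1 J * partexp f2 K)).
  by apply: eq_bigr => B _; rewrite mulr_sumr; apply: eq_bigr => J _; rewrite mulrA.
apply: partexp_unique => [|E x xE].
  rewrite /subconv (big_pred1 set0) => [|J]; last by rewrite subset0.
  by rewrite setD0 !partexp0 mulr1.
under eq_bigr do rewrite mulrDl.
rewrite big_split /= -half //.
under [X in _ + X]eq_bigr do rewrite subconvC.
rewrite -half // {1}/subconv (bigID (fun J : {set N} => x \in J)) /=; congr (_ + _).
rewrite big_mkcondr /=.
rewrite (sum_subset_compl (fun J K => if x \notin J then partexp f J * partexp g K else 0)).
rewrite [RHS]big_mkcondr; apply: eq_bigr => J _.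
by rewrite inE xE andbT negbK mulrC.
Qed.

Lemma partexp_zero D : partexp (fun=> 0) D = (D == set0)%:R.
Proof.
have [->|/set0Pn[x xD]] := eqVneq D set0; first exact: partexp0.
by rewrite (partexp_rec _ xD) big1 // => B _; rewrite mul0r.
Qed.

Lemma partexp_oppr f D :
  subconv (partexp f) (partexp (fun B => - f B)) D = (D == set0)%:R.
Proof.
rewrite -partexpD -partexp_zero; apply: eq_partexp => B _ _; exact: subrr.
Qed.

Section Logarithm.
Variable mu : {set N} -> A.
Hypothesis mu0 : mu set0 = 1.

(** The weights are the coefficients of [1 / (1 + t) = sum (-1)^k t^k], with
    [t^k] counting each partition into [k] blocks [k!] times, and [mu = 1 + t].
    According as the factor [mu] contributes no block or one of the [n] blocks, a
    partition gets the total weight [(-1)^n n! + n (-1)^(n-1) (n-1)!], which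
    vanishes unless [n] is zero. *)
Lemma subconv_partsum_inv D :
  subconv mu (partsum (fun k => (-1) ^+ k * k`!%:R) mu) D = (D == set0)%:R.
Proof.
rewrite /subconv (bigD1 set0) ?sub0set //= setD0 mu0 mul1r.
transitivity (\sum_(pi | partition pi D) ((-1) ^+ #|pi| * #|pi|`!%:R *
    \prod_(B in pi) mu B + \sum_(B in pi) (mu B *
       ((-1) ^+ #|pi :\ B| * #|pi :\ B|`!%:R * \prod_(C in pi :\ B) mu C)))).
  rewrite big_split /= (sum_partition_block (fun B pi => mu B *
    ((-1) ^+ #|pi| * #|pi|`!%:R * \prod_(C in pi) mu C))).
  by congr (_ + _); apply: eq_bigr => B _; rewrite mulr_sumr.
rewrite -partexp_zero; apply: eq_bigr => pi _.
have [->|/set0Pn[B Bpi]] := eqVneq pi set0.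
  by rewrite cards0 !big_set0 expr0 fact0 !mulr1 addr0.
rewrite [RHS](big_setD1 B) //= mul0r.
have blockE C : C \in pi -> mu C * ((-1) ^+ #|pi :\ C| * #|pi :\ C|`!%:R *
    \prod_(E in pi :\ C) mu E) =
    (-1) ^+ #|pi|.-1 * #|pi|.-1`!%:R * \prod_(E in pi) mu E.
  by move=> Cpi; rewrite (cardsD1 C pi) Cpi add1n /= [in RHS](big_setD1 C) //= mulrCA.
rewrite (eq_bigr _ blockE) sumr_const.
rewrite (cardsD1 B pi) Bpi add1n /= exprS factS natrM.
by rewrite mulN1r !mulNr mulrCA -[X in _ + X]mulr_natl !mulrA addNr.
Qed.

(** Restricted to the sets containing [x], the logarithm is [mu] on those sets
    convolved with the inverse of [mu]; hence [mu] obeys the recursion of the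
    exponential. *)
Lemma partexp_log D :
  partexp (partsum (fun k => (-1) ^+ k.-1 * k.-1`!%:R) mu) D = mu D.
Proof.
move: D; set kappa := partsum _ _.
suff : forall D, mu D = partexp kappa D by move=> H D; rewrite H.
apply: partexp_unique => // D x xD.
rewrite /kappa.
pose W := partsum (fun k => (-1) ^+ k * k`!%:R) mu.
transitivity (\sum_(J : {set N} | J \subset D)
    \sum_(B : {set N} | (B \subset J) && (x \in B)) mu B * W (J :\: B) * mu (D :\: J)).
  rewrite (sum_subset_chain (fun B => x \in B) (fun B J E => mu B * W J * mu E)).
  transitivity (\sum_(B : {set N} | (B \subset D) && (x \in B))
                   mu B * (D :\: B == set0)%:R).
    rewrite (bigD1 D) /= ?subxx // setDv eqxx mulr1 big1 ?addr0 // => B.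
    move=> /andP[/andP[sBD _] BD]; rewrite setD_eq0.
    by move: BD; rewrite eqEsubset sBD /= => /negPf ->; rewrite mulr0.
  apply: eq_bigr => B _; rewrite -subconv_partsum_inv subconvC mulr_sumr.
  by apply: eq_bigr => J _; rewrite mulrA.
rewrite [RHS]big_mkcondr; apply: eq_bigr => J _; case: ifP => xJ; last first.
  by rewrite big1 // => B /andP[/subsetP sBJ /sBJ]; rewrite xJ.
by rewrite (partsum_rec _ _ xJ) mulr_suml.
Qed.

End Logarithm.
End SetFunctions.

Lemma partexp_rmorph (N : finType) (A A' : comNzRingType)
    (h : {rmorphism A -> A'}) (f : {set N} -> A) D :
  h (partexp f D) = partexp (h \o f) D.
Proof.
by rewrite rmorph_sum; apply: eq_bigr => pi _; rewrite rmorph_prod.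
Qed.

(** The Leonov-Shiryaev formula: these are the coefficients of
    [log (1 + t) = sum (-1)^(k-1) t^k / k], with [t^k] counting each partition into
    [k] blocks [k!] times. *)
Definition partlog (N : finType) (A : comNzRingType) (mu : {set N} -> A) : {set N} -> A :=
  partsum (fun k => (-1) ^+ k.-1 * k.-1`!%:R) mu.

Lemma partlog_rmorph (N : finType) (A A' : comNzRingType)
    (h : {rmorphism A -> A'}) (f : {set N} -> A) D :
  h (partlog f D) = partlog (h \o f) D.
Proof.
rewrite rmorph_sum; apply: eq_bigr => pi _.
by rewrite !rmorphM rmorphXn rmorphN1 rmorph_nat rmorph_prod.
Qed.

Lemma partsum_imset (N N' : finType) (A : comNzRingType) (u : N -> N')
    (c : nat -> A) (f : {set N'} -> A) (D : {set N}) : injective u ->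
  partsum c f (u @: D) = partsum c (fun B : {set N} => f (u @: B)) D.
Proof.
move=> uI; have uuI := imset_inj uI.
pose im (pi : {set {set N}}) := [set u @: (B : {set N}) | B in pi].
pose pre (pi : {set {set N'}}) := [set u @^-1: (B : {set N'}) | B in pi].
have imK pi : pre (im pi) = pi.
  rewrite /pre /im -imset_comp -[RHS]imset_id; apply: eq_imset => B /=.
  by apply/setP => x; rewrite inE mem_imset.
rewrite /partsum (reindex_onto im pre) /=; last first.
  move=> pi piD; rewrite /im /pre -imset_comp -[RHS]imset_id.
  apply: eq_in_imset => B Bpi /=; apply/setP => y; apply/imsetP/idP.
    by case=> x; rewrite inE => ? ->.
  move=> yB; have /subsetP/(_ y yB)/imsetP[x _ yE] := partitionS piD Bpi.
  by exists x; rewrite // inE -yE.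
apply: eq_big => [pi|pi _]; first by rewrite imset_partition// imK eqxx andbT.
by rewrite card_imset// big_imset//= => ? ? _ _; exact: uuI.
Qed.

Lemma partsum1 (N : finType) (A : comNzRingType) c (f : {set N} -> A) x :
  partsum c f [set x] = c 1%N * f [set x].
Proof.
rewrite (partsum_rec _ _ (set11 x)) (big_pred1 [set x]).
  by rewrite setDv /partsum (big_pred1 set0) ?cards0 ?big_set0 ?mulr1 1?mulrC // => pi;
    exact: partition_set0.
by move=> B; rewrite subset1 /=; case: eqVneq => [->|_] /=; rewrite ?set11 //;
  case: eqP => // ->; rewrite inE.
Qed.

Lemma partexp1 (N : finType) (A : comNzRingType) (f : {set N} -> A) x :
  partexp f [set x] = f [set x].
Proof. by rewrite partexpE partsum1 mul1r. Qed.

Lemma partlog1 (N : finType) (A : comNzRingType) (f : {set N} -> A) x :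
  partlog f [set x] = f [set x].
Proof. by rewrite /partlog partsum1 !mul1r. Qed.

(** * Rows, flat sets and connected components *)

Section Singletons.
Variables (N : finType) (A : comNzRingType).

(** The sum over [B] reads off the value at the only element of [B]. *)
Definition on_singletons (v : N -> A) (B : {set N}) : A :=
  if #|B| == 1%N then \sum_(t in B) v t else 0.

Lemma partexp_on_singletons v D : partexp (on_singletons v) D = \prod_(t in D) v t.
Proof.
apply/esym; move: D; apply: partexp_unique => [|D x xD]; first by rewrite big_set0.
rewrite (bigD1 [set x]) /= ?sub1set ?xD ?set11 // [X in _ + X]big1 ?addr0.
  by rewrite [LHS](big_setD1 x) //= /on_singletons cards1 eqxx big_set1.
move=> B /andP[/andP[_ xB] Bx]; rewrite /on_singletons; case: ifP; rewrite ?mul0r//.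
by case/cards1P => t Bt; move: xB Bx; rewrite Bt inE => /eqP ->; rewrite eqxx.
Qed.

End Singletons.

Section Rows.
Variables (N L : finType) (row : N -> L).
Implicit Types (B D E K : {set N}) (S J : {set L}) (pi : {set {set N}}).

Definition rowset S : {set N} := row @^-1: S.

Definition flat B : bool := [exists k, B \subset rowset [set k]].

Section Flat.
Variable A : comNzRingType.
Implicit Types f : {set N} -> A.

(** The recursion at [x] on the right only involves blocks inside the row of
    [x], so it acts on one factor of the product and leaves the others alone. *)
Lemma partexp_flat f D :
  \prod_k partexp f (D :&: rowset [set k]) =
  partexp (fun B => if flat B then f B else 0) D.
Proof.
move: D; apply: partexp_unique => [|D x xD].
  by rewrite big1 // => k _; rewrite set0I partexp0.
have xr : x \in D :&: rowset [set row x] by rewrite !inE xD eqxx.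
rewrite (bigD1 (row x)) //= (partexp_rec _ xr) mulr_suml.
rewrite [LHS]big_mkcond [RHS]big_mkcond /=; apply: eq_bigr => B _.
rewrite subsetI; case: (boolP (B \subset D)) => //= sBD.
case: (boolP (x \in B)) => xB; rewrite ?andbF // andbT.
case: ifPn => sBr; last first.
  case: ifP; rewrite ?mul0r// => /existsP[k sBk]; case/negP: sBr.
  by move: (subsetP sBk _ xB); rewrite !inE => /eqP ->.
have -> : flat B by apply/existsP; exists (row x).
rewrite [in RHS](bigD1 (row x)) //= -mulrA setIDAC; congr (_ * (_ * _)).
apply: eq_bigr => k kx; congr partexp; rewrite setIDAC; apply/esym/setDidPl.
rewrite -setI_eq0 -subset0; apply/subsetP => t; rewrite !inE => /andP[/andP[_ tk] tB].
by move: (subsetP sBr _ tB) tk kx; rewrite !inE => /eqP -> /eqP ->; rewrite eqxx.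
Qed.

End Flat.

Lemma partition_restrict pi D (E1 E2 : {set N}) : [disjoint E1 & E2] -> E1 \subset D ->
  partition pi D -> {in pi, forall B, (B \subset E1) || (B \subset E2)} ->
  partition (pi ::&: E1) E1.
Proof.
move=> dE sE1D piD resp; apply/and3P; split.
- rewrite eqEsubset (subset_trans (cover_setI _ _)) ?subsetIr //=.
  apply/subsetP => x xE1; have : x \in cover pi.
    by rewrite (cover_partition piD) (subsetP sE1D).
  case/bigcupP => B Bpi xB; apply/bigcupP; exists B => //; rewrite inE Bpi /=.
  case/orP: (resp B Bpi) => // /subsetP/(_ x xB) xE2.
  by rewrite (disjointFr dE xE1) in xE2.
- exact/trivIsetI/(partition_trivIset piD).
- by rewrite inE (partition0 piD).
Qed.

Lemma partition_setU pi1 pi2 (D1 D2 : {set N}) : [disjoint D1 & D2] ->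
  partition pi1 D1 -> partition pi2 D2 -> partition (pi1 :|: pi2) (D1 :|: D2).
Proof.
move=> dD p1 p2; apply/and3P; split.
- by rewrite /cover bigcup_setU -!/(cover _) (cover_partition p1) (cover_partition p2).
- apply/trivIsetP => B C; rewrite !inE.
  have d12 B1 B2 : B1 \in pi1 -> B2 \in pi2 -> [disjoint B1 & B2].
    move=> B1p B2p; apply: disjointWl (partitionS p1 B1p) _.
    exact: disjointWr (partitionS p2 B2p) _.
  move=> /orP[Bp|Bp] /orP[Cp|Cp] BC.
  + exact: (trivIsetP (partition_trivIset p1)).
  + exact: d12.
  + by rewrite disjoint_sym; exact: d12.
  + exact: (trivIsetP (partition_trivIset p2)).
- by rewrite inE (partition0 p1) (partition0 p2).
Qed.

(** A partition all of whose blocks lie in one of two disjoint sets is a pair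
    of partitions; the inverse keeps the blocks contained in each set. *)
Lemma sum_partition_setU (V : nmodType) (F : {set {set N}} -> V) (D1 D2 : {set N}) :
  [disjoint D1 & D2] ->
  \sum_(pi | partition pi (D1 :|: D2) &&
             [forall B in pi, (B \subset D1) || (B \subset D2)]) F pi =
  \sum_(pi1 | partition pi1 D1) \sum_(pi2 | partition pi2 D2) F (pi1 :|: pi2).
Proof.
move=> dD; rewrite pair_big /=.
rewrite (reindex_onto (fun p : {set {set N}} * {set {set N}} => p.1 :|: p.2)
          (fun pi => (pi ::&: D1, pi ::&: D2))) /=; last first.
  move=> pi /andP[piD /forall_inP resp]; apply/setP => B; rewrite !inE -andb_orr.
  by case: (boolP (B \in pi)) => //= /resp.
apply: eq_bigl => -[pi1 pi2] /=; apply/idP/idP.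
  case/andP=> /andP[piD /forall_inP resp] /eqP[e1 e2].
  apply/andP; split; [rewrite -e1 | rewrite -e2].
    exact: partition_restrict dD (subsetUl _ _) piD resp.
  rewrite disjoint_sym in dD.
  by apply: partition_restrict dD (subsetUr _ _) piD _ => B /resp; rewrite orbC.
case/andP => p1 p2; rewrite partition_setU //=.
have sub1 B : B \in pi1 -> (B \subset D1) && ~~ (B \subset D2).
  move=> Bp; rewrite (partitionS p1 Bp) /=.
  apply: contra (partition_neq0 p1 Bp) => sBD2.
  rewrite -subset0 -(disjoint_setI0 dD) subsetI sBD2.
  by rewrite (partitionS p1 Bp).
have sub2 B : B \in pi2 -> (B \subset D2) && ~~ (B \subset D1).
  move=> Bp; rewrite (partitionS p2 Bp) /=.
  apply: contra (partition_neq0 p2 Bp) => sBD1.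
  rewrite -subset0 -(disjoint_setI0 dD) subsetI sBD1.
  by rewrite (partitionS p2 Bp).
apply/andP; split.
  by apply/forall_inP => B; rewrite inE => /orP[/sub1|/sub2] /andP[-> _]; rewrite ?orbT.
apply/eqP; congr pair; apply/setP => B; rewrite !inE.
  case: (boolP (B \in pi1)) => [/sub1/andP[-> _]//|_] /=.
  by case: (boolP (B \in pi2)) => // /sub2/andP[_ /negPf ->].
case: (boolP (B \in pi2)) => [/sub2/andP[-> _]//|_] /=; first by rewrite orbT.
by rewrite orbF; case: (boolP (B \in pi1)) => // /sub1/andP[_ /negPf ->].
Qed.

(** Connectedness is handled through the least set of rows that contains those
    of [K] and is stable under sharing a block of [pi], rather than through
    chains of blocks: stability can be checked block by block. *)
Definition row_closed pi K J : bool :=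
  (K \subset rowset J) &&
  [forall B in pi, (B \subset rowset J) || (B \subset rowset (~: J))].

Definition row_component pi K : {set L} := \bigcap_(J | row_closed pi K J) J.

Lemma row_component_min pi K J : row_closed pi K J -> row_component pi K \subset J.
Proof. exact: bigcap_inf. Qed.

Lemma rowsetS S J : S \subset J -> rowset S \subset rowset J.
Proof. exact: preimsetS. Qed.

Lemma row_component_closed pi K : row_closed pi K (row_component pi K).
Proof.
apply/andP; split.
  apply/subsetP => t tK; rewrite inE; apply/bigcapP => J /andP[/subsetP sK _].
  by have := sK _ tK; rewrite inE.
apply/forall_inP => B Bpi.
have [[J clJ sBJ]|noJ] :
    {J | row_closed pi K J & B \subset rowset (~: J)} +
    (forall J, row_closed pi K J -> B \subset rowset J).
  case: (pickP (fun J => row_closed pi K J && (B \subset rowset (~: J)))) => [J|noJ].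
    by case/andP => clJ sBJ; left; exists J.
  right=> J clJ; have := noJ J; rewrite clJ /= => sBJ.
  by case/andP: clJ => _ /forall_inP/(_ B Bpi); rewrite sBJ orbF.
  apply/orP; right; apply: subset_trans sBJ _; apply: rowsetS.
  by rewrite setCS; apply: row_component_min.
apply/orP; left; apply/subsetP => t tB; rewrite inE; apply/bigcapP => J clJ.
by have := subsetP (noJ J clJ) _ tB; rewrite inE.
Qed.

(** Blocks that avoid a closed set do not influence the component inside it. *)
Lemma row_component_setU pi1 pi2 K J : K \subset rowset J ->
  {in pi1, forall B, B \subset rowset J} ->
  {in pi2, forall B, B \subset rowset (~: J)} ->
  row_component (pi1 :|: pi2) K = row_component pi1 K.
Proof.
move=> sKJ s1 s2; apply/eqP; rewrite eqEsubset; apply/andP; split.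
  have /andP[sKc cl1] := row_component_closed pi1 K.
  have sJ : row_component pi1 K \subset J.
    apply: row_component_min; rewrite /row_closed sKJ.
    by apply/forall_inP => B /s1 ->.
  apply: row_component_min; rewrite /row_closed sKc /=; apply/forall_inP => B.
  rewrite inE => /orP[Bpi|/s2 sB]; first exact: (forall_inP cl1).
  by apply/orP; right; apply: subset_trans sB (rowsetS _); rewrite setCS.
have /andP[sKc cl] := row_component_closed (pi1 :|: pi2) K.
apply: row_component_min; rewrite /row_closed sKc /=; apply/forall_inP => B Bpi.
by apply: (forall_inP cl); rewrite inE Bpi.
Qed.

(** Classify the partitions by the component [J] of [K]: no block straddles
    [J] and its complement, and the blocks outside [J] are unconstrained. *)
Lemma partexp_row_component (A : comNzRingType) (f : {set N} -> A) K S :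
  K \subset rowset S ->
  partexp f (rowset S :\: K) =
  \sum_(J : {set L} | (J \subset S) && (K \subset rowset J))
    (\sum_(pi | partition pi (rowset J :\: K) && (row_component pi K == J))
       \prod_(B in pi) f B) * partexp f (rowset (S :\: J)).
Proof.
move=> sKS; rewrite {1}/partexp.
rewrite (partition_big (row_component ^~ K)
  (fun J => (J \subset S) && (K \subset rowset J))) /=; last first.
  move=> pi piD; case/andP: (row_component_closed pi K) => -> _.
  rewrite andbT; apply: row_component_min; rewrite /row_closed sKS.
  apply/forall_inP => B Bpi; rewrite (subset_trans (partitionS piD Bpi)) //.
  exact: subsetDl.
apply: eq_bigr => J /andP[sJS sKJ].
have DE : rowset S :\: K = (rowset J :\: K) :|: rowset (S :\: J).
  apply/setP => t; rewrite !inE; case: (boolP (row t \in J)) => /= tJ.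
    by rewrite orbF (subsetP sJS _ tJ).
  have -> : t \notin K by apply: contra tJ => /(subsetP sKJ); rewrite inE.
  by [].
have dD : [disjoint rowset J :\: K & rowset (S :\: J)].
  rewrite -setI_eq0 -subset0; apply/subsetP => t; rewrite !inE.
  by case: (row t \in J); rewrite ?andbF.
transitivity (\sum_(pi | partition pi ((rowset J :\: K) :|: rowset (S :\: J)) &&
     [forall B in pi, (B \subset rowset J :\: K) || (B \subset rowset (S :\: J))])
    if row_component pi K == J then \prod_(B in pi) f B else 0).
  rewrite -big_mkcondr; apply: eq_bigl => pi; rewrite DE -andbA.
  case: (boolP (partition pi _)) => //= piD.
  apply/idP/andP => [/eqP cJ|[]//]; split; last by rewrite cJ.
  case/andP: (row_component_closed pi K) => _ /forall_inP cl.
  apply/forall_inP => B Bpi; have := cl _ Bpi; rewrite cJ.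
  have := partitionS piD Bpi; rewrite -DE => sBD /orP[sB|sB]; apply/orP.
    left; apply/subsetP => t tB; have := subsetP sBD _ tB.
    by rewrite !inE => /andP[-> _]; have := subsetP sB _ tB; rewrite inE.
  right; apply/subsetP => t tB; have := subsetP sBD _ tB.
  by rewrite !inE => /andP[_ ->]; have := subsetP sB _ tB; rewrite !inE => ->.
rewrite sum_partition_setU // [in RHS]big_mkcondr mulr_suml /=.
apply: eq_bigr => pi1 p1.
transitivity (\sum_(pi2 | partition pi2 (rowset (S :\: J)))
  (if row_component pi1 K == J then \prod_(B in pi1) f B else 0) *
     \prod_(B in pi2) f B); last by rewrite mulr_sumr.
apply: eq_bigr => pi2 p2.
rewrite (@row_component_setU _ _ _ J) //.
- case: ifP; rewrite ?mul0r// => _.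
  rewrite -bigU /=; first by apply: eq_bigl => B; rewrite !inE.
  rewrite -setI_eq0 -subset0; apply/subsetP => B; rewrite !inE => /andP[B1 B2].
  case/negP: (partition_neq0 p1 B1).
  rewrite -subset0 -(disjoint_setI0 dD) subsetI.
  by rewrite (partitionS p1 B1) (partitionS p2 B2).
- move=> B Bp; apply: subset_trans (partitionS p1 Bp) _; exact: subsetDl.
- move=> B Bp; apply: subset_trans (partitionS p2 Bp) (rowsetS _).
  by rewrite setDE subsetIr.
Qed.


(** * Products of row-wise exponentials *)

Section WickExpansion.
Variables (A : comNzRingType) (e kappa : {set N} -> A).
Hypothesis e_flat : forall B, ~~ flat B -> e B = 0.

Definition nonflat_part B : A := if flat B then 0 else kappa B.

Let W := partexp (fun B => e B - kappa B).
Let mu S : A := partexp nonflat_part (rowset S).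

(** Singletons are flat, so the flat part of [e - kappa] is [e] minus the flat
    part of [kappa], which is [e - kappa] plus the non-flat part of [kappa]. *)
Lemma prod_rows S :
  \prod_(k in S) W (rowset [set k]) = subconv W (partexp nonflat_part) (rowset S).
Proof.
rewrite -partexpD -(@eq_partexp _ _
    (fun B => if flat B then e B - kappa B else 0)); last first.
  move=> B _ _; rewrite /nonflat_part; case: ifPn => [_|/e_flat ->].
    by rewrite addr0.
  by rewrite sub0r addNr.
rewrite -partexp_flat big_mkcond; apply: eq_bigr => k _; case: ifPn => kS.
  by congr partexp; apply/esym/setIidPr/rowsetS; rewrite sub1set.
rewrite (_ : _ :&: _ = set0) ?partexp0 //; apply/setP => t; rewrite !inE.
by case: eqP => [->|]; rewrite ?(negPf kS) ?andbF.
Qed.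

Definition connected_sum S : A :=
  \sum_(K : {set N} | (K \subset rowset S) && (K != set0))
    W K * \sum_(pi | partition pi (rowset S :\: K) && (row_component pi K == S))
             \prod_(B in pi) nonflat_part B.

Lemma rowset0 : rowset set0 = set0.
Proof. exact: preimset0. Qed.

(** Exchanging the sums over [K] and [J], the inner sum over [J] is the
    decomposition of [mu] by the component of [K]; the unit accounts for the empty
    [K], which has no component. *)
Lemma subconv_connected S :
  subconv (fun J => (J == set0)%:R + connected_sum J) mu S =
  subconv W (partexp nonflat_part) (rowset S).
Proof.
rewrite /subconv; under eq_bigr do rewrite mulrDl; rewrite big_split /=.
rewrite [RHS](bigD1 set0) ?sub0set //= /W partexp0 mul1r setD0; congr (_ + _).
  by rewrite -[LHS]/(subconv _ mu S) subconvC subconv1.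
under eq_bigr do rewrite mulr_suml.
rewrite (exchange_big_dep (fun K => (K \subset rowset S) && (K != set0))) /=; last first.
  move=> J K sJS /andP[sKJ ->]; rewrite andbT.
  exact: subset_trans sKJ (rowsetS sJS).
apply: eq_bigr => K /andP[sKS K0].
rewrite (partexp_row_component _ sKS) mulr_sumr.
by apply: eq_big => [J|J _]; rewrite ?K0 ?andbT // mulrA.
Qed.

(** Convolve the previous identity with the inverse of [mu]. *)
Lemma wick_expansion S :
  subconv (fun J => \prod_(k in J) W (rowset [set k]))
       (partexp (fun J => - partlog mu J)) S = (S == set0)%:R + connected_sum S.
Proof.
have mu0 : mu set0 = 1 by rewrite /mu rowset0 partexp0.
rewrite (@eq_subconv _ _ _ (subconv (fun J => (J == set0)%:R + connected_sum J) mu) _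
  (partexp (fun J => - partlog mu J))) //; last first.
  by move=> J _; rewrite subconv_connected prod_rows.
rewrite subconvA -[RHS](subconv1 (fun J => (J == set0)%:R + connected_sum J)).
apply: eq_subconv => // J _; rewrite -(partexp_oppr (partlog mu)).
by apply: eq_subconv => // E _; rewrite partexp_log.
Qed.

End WickExpansion.

End Rows.

From mathcomp Require Import finmap.
From mathcomp Require Import all_classical all_reals all_analysis.
From mathcomp Require Import -(notations) monalg.

(** * Evaluating and substituting in polynomials *)

Section MonomialEvaluation.
Variables (I : choiceType) (S : comNzRingType).

Definition monval (v : I -> S) (m : cmonom I) : S :=
  \prod_(i <- finsupp m) v i ^+ m i.

Lemma monvalEw v (m : cmonom I) (E : {fset I}) : fsubset (finsupp m) E ->
  monval v m = \prod_(i <- E) v i ^+ m i.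
Proof.
move=> sE; apply: big_fset_incl => // i _ im.
by rewrite (fsfun_dflt im) expr0.
Qed.

Lemma monval_is_monoid_morphism v : monalg.mmorphism (monval v).
Proof.
split=> [m1 m2|]; last by rewrite /monval mdom1 big_seq_fset0.
rewrite (@monvalEw _ m1 (finsupp (monalg.mmul m1 m2))); last by rewrite mdomD fsubsetUl.
rewrite (@monvalEw _ m2 (finsupp (monalg.mmul m1 m2))); last by rewrite mdomD fsubsetUr.
by rewrite -big_split /=; apply: eq_bigr => i _; rewrite cmM exprD.
Qed.

HB.instance Definition _ v :=
  monalg.isMultiplicative.Build (cmonom I) S (monval v) (monval_is_monoid_morphism v).

Lemma monvalU v i : monval v (ucm i) = v i.
Proof. by rewrite /monval mdomU big_seq_fset1 cmUU expr1. Qed.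

End MonomialEvaluation.

Section Evaluation.
Variables (R : realType) (I : choiceType).

Lemma psubstE (J : choiceType) (v : I -> polyring R J) p :
  psubst v p = mmap (malgC : R -> polyring R J) (monval v) p.
Proof. by []. Qed.

Lemma pevalE (v : I -> R) p : peval v p = mmap idfun (monval v) p.
Proof. by []. Qed.

Lemma peval_indet (v : I -> R) i : peval v (indet R i) = v i.
Proof. by rewrite pevalE mmapU mul1r monvalU. Qed.

Lemma psubst_indet (J : choiceType) (v : I -> polyring R J) i :
  psubst v (indet R i) = v i.
Proof. by rewrite psubstE mmapU mul_malgC scale1r monvalU. Qed.

Lemma psubst_prod (J : choiceType) (v : I -> polyring R J) (N : finType)
    (Q : pred N) F :
  psubst v (\prod_(t | Q t) F t) = \prod_(t | Q t) psubst v (F t).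
Proof. by rewrite psubstE rmorph_prod. Qed.

Lemma psubst_sum (J : choiceType) (v : I -> polyring R J) (N : finType)
    (Q : pred N) F :
  psubst v (\sum_(t | Q t) F t) = \sum_(t | Q t) psubst v (F t).
Proof. by rewrite psubstE raddf_sum. Qed.

Lemma psubstZ (J : choiceType) (v : I -> polyring R J) c p :
  psubst v (c *: p) = c *: psubst v p.
Proof. by rewrite psubstE mmapZ mul_malgC. Qed.

Lemma peval_prod (v : I -> R) (N : finType) (Q : pred N) F :
  peval v (\prod_(t | Q t) F t) = \prod_(t | Q t) peval v (F t).
Proof. by rewrite pevalE rmorph_prod. Qed.

Lemma pevalD (v : I -> R) p q : peval v (p + q) = peval v p + peval v q.
Proof. by rewrite pevalE raddfD. Qed.

Lemma pevalZ (v : I -> R) c p : peval v (c *: p) = c * peval v p.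
Proof. by rewrite pevalE mmapZ. Qed.

End Evaluation.

Section Expectation.
Context {d : measure_display} {T : measurableType d} {R : realType}.
Variables (P : probability T R) (I : choiceType) (X : I -> T -> R).
Hypothesis hX : forall s : seq I,
  P.-integrable [set: T] (EFin \o (fun w => \prod_(i <- s) X i w)).

Definition pexpect (p : polyring R I) : R :=
  fine 'E_P[fun w => peval (X ^~ w) p].

Lemma pexpectE p : pexpect p = \int[P]_w peval (X ^~ w) p.
Proof. by rewrite /pexpect unlock. Qed.

(** A polynomial in the [X i] is a finite combination of products of the
    [X i], with repetitions given by the exponents. *)
Lemma integrable_peval (p : polyring R I) :
  P.-integrable [set: T] (EFin \o (fun w => peval (X ^~ w) p)).
Proof.
have monE w (m : cmonom I) : monval (X ^~ w) m =
    \prod_(i <- flatten [seq nseq (m i) i | i <- finsupp m]) X i w.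
  rewrite big_flatten big_map /=; apply: eq_bigr => i _.
  by rewrite big_nseq iter_mulr_1.
have -> : EFin \o (fun w => peval (X ^~ w) p) =
    (fun w => \sum_(m <- msupp p) (mcoeff m p)%:E *
       (\prod_(i <- flatten [seq nseq (m i) i | i <- finsupp m]) X i w)%:E)%E.
  apply/funext => w /=; rewrite pevalE /mmap -sumEFin.
  by apply: eq_bigr => m _; rewrite EFinM monE.
apply: integrable_sum => // m _; apply: integrableZl => //; exact: hX.
Qed.

Lemma pexpectD p q : pexpect (p + q) = pexpect p + pexpect q.
Proof.
rewrite !pexpectE -RintegralD //; try exact: integrable_peval.
by apply: eq_Rintegral => w _; rewrite pevalD.
Qed.

Lemma pexpectZ c p : pexpect (c *: p) = c * pexpect p.
Proof.
rewrite !pexpectE -RintegralZl //; last exact: integrable_peval.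
by apply: eq_Rintegral => w _; rewrite pevalZ.
Qed.

Lemma pexpect_sum (N : finType) (Q : pred N) (F : N -> polyring R I) :
  pexpect (\sum_(t | Q t) F t) = \sum_(t | Q t) pexpect (F t).
Proof.
apply: (big_morph pexpect pexpectD).
by have := pexpectZ 0 0; rewrite scaler0 mul0r.
Qed.

End Expectation.

(** * Appell polynomials as exponentials *)

Section AppellPartexp.
Context {d : measure_display} {T : measurableType d} {R : realType}.
Variables (P : probability T R) (I : choiceType) (X : I -> T -> R).

Lemma cumulant_partlog (N : finType) (Z : N -> T -> R) :
  cumulant P Z = partlog (moment P Z).
Proof. by []. Qed.

Lemma moment0 (N : finType) (Z : N -> T -> R) : moment P Z finset.set0 = 1.
Proof.
rewrite /moment [X in expectation P X](_ : _ = cst 1); first by rewrite expectation_cst.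
by apply/funext => w; rewrite big_set0.
Qed.

(** The moment on the empty set is 1, so the partition logarithm applies. *)
Lemma partexp_cumulant (N : finType) (Z : N -> T -> R) D :
  partexp (cumulant P Z) D = moment P Z D.
Proof. by rewrite cumulant_partlog partexp_log// moment0. Qed.

Section Labelled.
Variables (N : finType) (lab : N -> I).
Let kappa (B : {set N}) : polyring R I := (cumulant P (X \o lab) B)%:A.
Let var := on_singletons (fun t => indet R (lab t)).

Lemma partexp_scalar (f : {set N} -> R) D :
  partexp (fun B => (f B)%:A : polyring R I) D = (partexp f D)%:A.
Proof. by rewrite -[RHS]/(GRing.in_alg (polyring R I) _) partexp_rmorph. Qed.

Lemma appell_subconv D :
  appell P X lab D = \sum_(J : {set N} | J \subset D)
    partexp (fun B => - cumulant P (X \o lab) B) (D :\: J)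
       *: \prod_(t in J) indet R (lab t).
Proof.
rewrite /appell; apply: eq_bigr => J _; apply: (congr2 *:%R); last by [].
by apply: eq_bigr => pi _; rewrite /cumulant_part prodrN.
Qed.

Lemma appell_partexp D : appell P X lab D = partexp (fun B => var B - kappa B) D.
Proof.
rewrite appell_subconv partexpD; apply: eq_bigr => J _.
rewrite partexp_on_singletons mulrC -mulr_algl -partexp_scalar; congr (_ * _).
by apply: eq_partexp => B _ _; rewrite scaleNr.
Qed.

Lemma appell_set0 : appell P X lab finset.set0 = 1.
Proof. by rewrite appell_partexp partexp0. Qed.

Lemma appell_set1 t :
  appell P X lab [set t]%SET = indet R (lab t) - (moment P (X \o lab) [set t]%SET)%:A.
Proof.
rewrite appell_partexp partexp1 /var /on_singletons cards1 eqxx big_set1.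
by rewrite /kappa cumulant_partlog partlog1.
Qed.

End Labelled.

(** Reading the positions of a sequence as the nodes of one row among many needs
    an injective relabelling, which is not onto. *)
Lemma appell_imset (N N' : finType) (u : N -> N') (lab : N' -> I) (D : {set N}) :
  injective u -> appell P X (lab \o u) D = appell P X lab (u @: D)%SET.
Proof.
move=> uI; rewrite !appell_partexp [RHS]partexpE partsum_imset // -partexpE.
apply: eq_partexp => B _ _.
have varE : on_singletons (fun t => indet R (lab (u t))) B =
    on_singletons (fun t => indet R (lab t)) (u @: B)%SET.
  by rewrite /on_singletons card_imset // big_imset//= => ? ? _ _; exact: uI.
have cumE : cumulant P (X \o (lab \o u)) B = cumulant P (X \o lab) (u @: B)%SET.
  rewrite !cumulant_partlog /partlog [in RHS]partsum_imset //.
  apply: eq_bigr => pi _; congr (_ * _); apply: eq_bigr => C _.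
  rewrite /moment; congr (fine (expectation P _)); apply/funext => w.
  by rewrite big_imset//= => ? ? _ _; exact: uI.
by rewrite -varE -cumE.
Qed.

Hypothesis hX : forall s : seq I,
  P.-integrable [set: T] (EFin \o (fun w => \prod_(i <- s) X i w)).

Lemma pexpect_prod_indet (N : finType) (lab : N -> I) (J : {set N}) :
  pexpect P X (\prod_(t in J) indet R (lab t)) = moment P (X \o lab) J.
Proof.
rewrite /pexpect /moment; congr (fine (expectation P _)); apply/funext => w.
by rewrite peval_prod; apply: eq_bigr => t _; rewrite peval_indet.
Qed.

(** Expectation turns products of indeterminates into moments, that is, into
    the exponential of the cumulants, and the coefficients are the inverse of that
    exponential. *)
Lemma pexpect_appell (N : finType) (lab : N -> I) (D : {set N}) :
  pexpect P X (appell P X lab D) = (D == finset.set0)%:R.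
Proof.
rewrite appell_subconv pexpect_sum //.
rewrite -(partexp_oppr (cumulant P (X \o lab))).
apply: eq_bigr => J _.
by rewrite pexpectZ // pexpect_prod_indet partexp_cumulant mulrC.
Qed.

End AppellPartexp.

(** * Wick powers of centred variables *)

Section WickPower.
Context {d : measure_display} {T : measurableType d} {R : realType}.
Variables (P : probability T R) (m : nat) (Y : 'I_m -> T -> R).
Hypothesis Y_centered : forall k, moment P Y [set k]%SET = 0.

Lemma appell_seq_nil : appell_seq P Y [::] = 1.
Proof.
rewrite /appell_seq (_ : [set: _]%SET = finset.set0) ?appell_set0 //.
by apply/finset.setP => -[].
Qed.

(** For a centred variable the degree-one Appell polynomial is the bare
    indeterminate, so a Wick product of indeterminates is a single Appell
    polynomial. *)
Lemma appell_seq1 k : appell_seq P Y [:: k] = indet R k.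
Proof.
rewrite /appell_seq (_ : [set: _]%SET = [set ord0]%SET); last first.
  by apply/finset.setP => i; rewrite !inE ord1 eqxx.
rewrite appell_set1 (_ : moment _ _ _ = 0) ?scale0r ?subr0 //.
rewrite -(Y_centered k) /moment; congr (fine (expectation P _)).
by apply/funext => w; rewrite !big_set1.
Qed.

Lemma big_wick_indet (s : seq 'I_m) :
  \big[wick P Y/1]_(k <- s) indet R k = appell_seq P Y s.
Proof.
have [_ _ wickE] := wickP P Y.
elim: s => [|k s IH]; first by rewrite big_nil appell_seq_nil.
by rewrite big_cons IH -appell_seq1 wickE.
Qed.

Lemma big_wick_indetT :
  \big[wick P Y/1]_(k < m) indet R k = appell P Y id [set: 'I_m]%SET.
Proof.
rewrite big_wick_indet /appell_seq.
pose u := tnth (in_tuple (index_enum 'I_m)).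
rewrite -(@appell_bijT _ _ _ P _ Y _ _ u id) //.
have uI : injective u.
  by apply/tuple_uniqP; exact: index_enum_uniq.
by apply: inj_card_bij uI _; rewrite !card_ord -[X in (X <= _)%N]card_ord cardE
  enumT.
Qed.

End WickPower.

(** * Connected diagrams *)

Section Connectedness.
Variables (N : finType) (m : nat) (row : N -> 'I_m).
Implicit Types (pi : {set {set N}}) (K : {set N}).

Lemma nonflat_flat pi : nonflat row pi = [forall B in pi, ~~ flat row B].
Proof.
apply: eq_forallb => B; congr (_ ==> _); rewrite negb_exists.
apply: eq_forallb => k; congr (~~ _); apply/forall_inP/fintype.subsetP => H t tB.
  by rewrite !inE H.
by have := H t tB; rewrite !inE.
Qed.

Lemma closed_block pi K (J : {set 'I_m}) (H : {set N}) i j :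
  row_closed row pi K J -> H \in (K |: pi)%SET ->
  meets_row row H i -> meets_row row H j -> i \in J -> j \in J.
Proof.
case/andP => /fintype.subsetP sK /forall_inP cl HK.
case/exists_inP => s sH /eqP <-; case/exists_inP => t tH /eqP <-.
move: HK; rewrite !inE => /orP[/eqP HE|Hpi] sJ.
  by have := sK t; rewrite -HE !inE; apply.
case/orP: (cl H Hpi) => /fintype.subsetP sub; first by have := sub t tH; rewrite inE.
by have := sub s sH; rewrite !inE sJ.
Qed.

(** A chain of blocks starting at [K] cannot leave a closed set.  Conversely, the
    rows reachable from a row of [K] form a closed set, and then so do the rows
    from which every row is reachable. *)
Lemma connected_diagramP pi K : K != finset.set0 ->
  connected_diagram row pi K <-> row_component row pi K = [set: 'I_m]%SET.
Proof.
case/set0Pn => t0 t0K.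
have KP : K \in (K |: pi)%SET by rewrite !inE eqxx.
split=> [conn|compT].
  apply/eqP; rewrite finset.eqEsubset finset.subsetT /=; apply/fintype.subsetP => j _.
  have cl := row_component_closed row pi K.
  have kJ : row t0 \in row_component row pi K.
    by case/andP: (cl) => /fintype.subsetP/(_ _ t0K); rewrite inE.
  have [H [s [allHs mH ml ps]]] := conn (row t0) j.
  move: (row t0) kJ mH => i iJ mH.
  elim: s H i iJ mH allHs ml ps => [|H' s IH] H i iJ mH /=.
    by rewrite andbT => HP ml _; exact: closed_block cl HP mH ml iJ.
  case/andP => HP allHs ml /andP[/existsP[k /andP[mHk mH'k]] ps].
  by apply: (IH H' k) => //; exact: closed_block cl HP mH mHk iJ.
have from_K k j : meets_row row K k -> row_equiv row (K |: pi)%SET k j.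
  (* A block of [pi] appended to a chain extends it forwards. *)
  move=> mk; pose J := [set j | `[< row_equiv row (K |: pi)%SET k j >]]%SET.
  suff clJ : row_closed row pi K J.
    have := fintype.subsetP (row_component_min clJ) j; rewrite compT !inE.
    by apply.
  apply/andP; split.
    apply/fintype.subsetP => t tK; rewrite !inE.
    have mt : meets_row row K (row t) by apply/exists_inP; exists t.
    by exists K, [::]; split; rewrite //= KP.
  apply/forall_inP => B Bpi.
  have [/existsP[t /andP[tB tJ]]|nJ] := boolP [exists t, (t \in B) && (row t \in J)].
    apply/orP; left; apply/fintype.subsetP => t' t'B; rewrite !inE.
    move: tJ; rewrite !inE => -[H [s [allHs mH ml ps]]].
    exists H, (rcons s B); split=> //.
    - by rewrite -rcons_cons all_rcons allHs andbT /= !inE Bpi orbT.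
    - by rewrite last_rcons; apply/exists_inP; exists t'.
    - rewrite rcons_path ps /=; apply/existsP; exists (row t); rewrite ml /=.
      by apply/exists_inP; exists t.
  apply/orP; right; apply/fintype.subsetP => t tB; rewrite inE finset.in_setC.
  by apply: contra nJ => tJ; apply/existsP; exists t; rewrite tB.
(* A block of [pi] prepended to a chain extends it backwards. *)
move=> i j; pose J := [set i | `[< forall j, row_equiv row (K |: pi)%SET i j >]]%SET.
suff clJ : row_closed row pi K J.
  have := fintype.subsetP (row_component_min clJ) i; rewrite compT !inE.
  by move=> /(_ isT)/asboolP.
apply/andP; split.
  apply/fintype.subsetP => t tK; rewrite !inE; apply/asboolP => j'.
  by apply: from_K; apply/exists_inP; exists t.
apply/forall_inP => B Bpi.
have [/existsP[t /andP[tB tJ]]|nJ] := boolP [exists t, (t \in B) && (row t \in J)].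
  apply/orP; left; apply/fintype.subsetP => t' t'B; rewrite !inE; apply/asboolP => j'.
  move: tJ; rewrite !inE => /asboolP/(_ j')[H [s [allHs mH ml ps]]].
  exists B, (H :: s); split=> //.
  - by apply/andP; split; [rewrite /= !inE Bpi orbT | exact: allHs].
  - by apply/exists_inP; exists t'.
  - rewrite /= ps andbT; apply/existsP; exists (row t); rewrite mH andbT.
    by apply/exists_inP; exists t.
apply/orP; right; apply/fintype.subsetP => t tB; rewrite inE finset.in_setC.
by apply: contra nJ => tJ; apply/existsP; exists t; rewrite tB.
Qed.

End Connectedness.

(** * The expansion over diagrams *)

Section RowExpansion.
Context {d : measure_display} {T : measurableType d} {R : realType}.
Variables (P : probability T R) (I : choiceType) (X : I -> T -> R).
Hypothesis hX : forall s : seq I,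
  P.-integrable [set: T] (EFin \o (fun w => \prod_(i <- s) X i w)).
Variables (m : nat) (r : 'I_m -> seq I).

Local Notation row := (@node_row I m r).
Local Notation lab := (@node_label I m r).
Let Y (k : 'I_m) : T -> R := appell_rv P X (r k).
Let e : {set row_node r} -> polyring R I := on_singletons (fun t => indet R (lab t)).
Let kappa (B : {set row_node r}) : polyring R I := (cumulant P (X \o lab) B)%:A.
Let kappaNF (B : {set row_node r}) : R := if flat row B then 0 else cumulant P (X \o lab) B.

Let e_flat B : ~~ flat row B -> e B = 0.
Proof.
rewrite /e /on_singletons; case: ifP => // /cards1P[t ->] /existsP[]; exists (row t).
by apply/fintype.subsetP => t'; rewrite !inE => /eqP ->.
Qed.

Lemma appell_seq_row k :
  appell_seq P X (r k) = appell P X lab (rowset row [set k]%SET).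
Proof.
pose u (i : 'I_(size (r k))) : row_node r := Tagged (fun k => 'I_(size (r k))) i.
have uI : injective u by move=> i j /eqP; rewrite eq_Tagged => /eqP.
have imT : (u @: [set: 'I_(size (r k))] = rowset row [set k])%SET.
  apply/finset.setP => -[k' i]; rewrite !inE.
  apply/imsetP/eqP => [[j _ /(congr1 (@tag _ _))]//|]; rewrite /node_row /= => kE.
  by subst k'; exists i; rewrite ?finset.in_setT.
rewrite -imT -(appell_imset P X lab _ uI).
by [].
Qed.

Let rowW k : appell_seq P X (r k) =
  partexp (fun B => e B - kappa B) (rowset row [set k]%SET).
Proof. by rewrite appell_seq_row appell_partexp. Qed.

Let partexp_kappaNF D : partexp (nonflat_part row kappa) D = (partexp kappaNF D)%:A.
Proof.
rewrite -partexp_scalar; apply: eq_partexp => B _ _.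
by rewrite /nonflat_part /kappaNF; case: ifP; rewrite ?scale0r.
Qed.

(** The joint moment is the expectation of the product of row-wise Appell
    polynomials; in the expansion of that product only the empty [K] survives. *)
Lemma moment_rows (S : {set 'I_m}) : moment P Y S = partexp kappaNF (rowset row S).
Proof.
transitivity (pexpect P X (\prod_(k in S) appell_seq P X (r k))).
  rewrite /moment /pexpect; congr (fine (expectation P _)); apply/funext => w.
  by rewrite peval_prod.
under eq_bigr do rewrite rowW; rewrite prod_rows // pexpect_sum //.
transitivity (subconv (fun J => (J == finset.set0)%:R) (partexp kappaNF) (rowset row S)).
  apply: eq_bigr => J _; rewrite partexp_kappaNF mulrC mulr_algl pexpectZ //.
  by rewrite -appell_partexp pexpect_appell // mulrC.
by rewrite subconvC subconv1.
Qed.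

Lemma rowset1_neq0 k : r k != [::] -> rowset row [set k]%SET != finset.set0.
Proof.
case E : (r k) => [|i s] // _.
have sz : (0 < size (r k))%N by rewrite E.
apply/set0Pn; exists (Tagged (fun k => 'I_(size (r k))) (Ordinal sz)).
by rewrite !inE.
Qed.

(** The coefficients of the left-hand side are the exponential of minus the
    cumulants of the [Y k], and those cumulants are the logarithm of [mu]. *)
Lemma psubst_appell_rows :
  psubst (fun j => appell_seq P X (r j)) (appell P Y id [set: 'I_m]%SET) =
  ([set: 'I_m]%SET == finset.set0)%:R + connected_sum row e kappa [set: 'I_m]%SET.
Proof.
rewrite -wick_expansion // appell_subconv psubst_sum; apply: eq_bigr => J _.
rewrite psubstZ psubst_prod mulrC -mulr_algl -partexp_scalar; congr (_ * _).
  apply: eq_partexp => B _ _; rewrite scaleNr cumulant_partlog; congr (- _).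
  rewrite -[LHS]/(GRing.in_alg (polyring R I) _) partlog_rmorph.
  apply: eq_bigr => pi _; congr (_ * _); apply: eq_bigr => C _ /=.
  by rewrite partexp_kappaNF -moment_rows.
by apply: eq_bigr => k _; rewrite psubst_indet rowW.
Qed.

Lemma connected_sum_diagrams :
  connected_sum row e kappa [set: 'I_m]%SET =
  \sum_(D : {set {set row_node r}} * {set row_node r} |
            `[< diagram_NFC row D.1 D.2 >] && (0 < #|D.2|)%N)
      cumulant_part P (X \o lab) D.1 *: appell P X lab D.2.
Proof.
have rowT : rowset row [set: 'I_m]%SET = [set: row_node r]%SET.
  by apply/finset.setP => t; rewrite !inE.
rewrite /connected_sum.
under eq_bigr do rewrite mulr_sumr.
under eq_bigl do rewrite rowT finset.subsetT /=.
rewrite pair_big_dep /=.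
rewrite (reindex (fun D : {set {set row_node r}} * {set row_node r} => (D.2, D.1))) /=;
  last by exists (fun D => (D.2, D.1)) => -[].
rewrite big_mkcond [RHS]big_mkcond /=; apply: eq_bigr => -[pi K] _ /=.
rewrite rowT finset.setTD card_gt0.
have [->|K0] := eqVneq K finset.set0; first by rewrite andbF.
rewrite andbT /=.
have prodE : \prod_(B in pi) nonflat_part row kappa B =
    if nonflat row pi then (cumulant_part P (X \o lab) pi)%:A else 0.
  rewrite nonflat_flat; case: ifPn => [/forall_inP nf|].
    rewrite /cumulant_part -[RHS]/(GRing.in_alg (polyring R I) _) rmorph_prod.
    by apply: eq_bigr => B Bpi; rewrite /nonflat_part (negPf (nf _ Bpi)).
  rewrite negb_forall_in => /exists_inP[B Bpi]; rewrite negbK => fB.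
  by rewrite (bigD1 B) //= {1}/nonflat_part fB mul0r.
rewrite prodE.
have [/andP[piK /eqP comp]|nconn] := ifPn; last first.
  case: ifP => // /asboolP[diag _ conn]; case/negP: nconn.
  move: diag; rewrite /is_diagram => -> /=; exact/eqP/connected_diagramP.
case: ifPn => nf; last first.
  by rewrite mulr0; case: ifP => // /asboolP[_ nf']; rewrite nf' in nf.
rewrite mulrC mulr_algl -appell_partexp ifT //.
by apply/asboolP; split=> //; apply/connected_diagramP.
Qed.

End RowExpansion.

Theorem theorem1p11 (R : realType) (d : measure_display) (T : measurableType d)
    (P : probability T R) (I : choiceType) (X : I -> {RV P >-> R})
    (hX : forall s : seq I,
      P.-integrable [set: T] (EFin \o (fun w => \prod_(i <- s) X i w)))
    (m : nat) (hm : (1 <= m)%N)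
    (r : 'I_m -> seq I) (hr : forall k, r k != [::]) :
  let Y := fun k : 'I_m => appell_rv P X (r k) in
  psubst (fun j => appell_seq P X (r j))
    (\big[wick P Y/1]_(k < m) indet R k)
  = \sum_(D : {set {set row_node r}} * {set row_node r} |
            `[< diagram_NFC (@node_row I m r) D.1 D.2 >] && (0 < #|D.2|)%N)
      cumulant_part P (fun t => X (node_label t)) D.1
        *: appell P X (@node_label I m r) D.2.
Proof.
move=> Y; rewrite big_wick_indetT; last first.
  move=> k; rewrite -[LHS](_ : pexpect P (fun i => X i) (appell_seq P X (r k)) = _).
    by rewrite appell_seq_row pexpect_appell // (negPf (rowset1_neq0 (hr k))).
  rewrite /moment /pexpect; congr (fine (expectation P _)); apply/funext => w.
  by rewrite big_set1.
rewrite psubst_appell_rows // connected_sum_diagrams.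
rewrite -finset.cards_eq0 cardsT card_ord (gtn_eqF hm) add0r.
by [].
Qed.
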